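(* Suppose utility is $u(W)=\log W$ with initial wealth $w_0>0$, and the distribution of (real-valued) output belongs to an exponential family with a linear sufficient statistic, i.e. $f(y\mid a)=h(y)\exp\bigl(\eta(a)y-\psi(a)\bigr)$ with $\eta,\psi$ differentiable in $a$. Then, for all multipliers $\lambda,\mu\in\mathbb R$, the canonical contract wage function $y\mapsto w_{\lambda,\mu}(y)$ is a piecewise linear option contract. This includes the case where output is Gaussian, exponential, Poisson, geometric, binomial, or gamma distributed.
   Context: Output $y$ has strictly positive density or mass function $f(y\mid a)$ (with respect to a common dominating measure) given the action $a$ in an interval $\mathcal A\subseteq\mathbb R_+$; $a_0$ is a fixed interior point of $\mathcal A$ and $s(y):=f_a(y\mid a_0)/f(y\mid a_0)$ is the score at $a_0$. For a utility function $u$ on $[w_0,\infty)$ with $u'>0$, $u''<0$, $u'\to0$ at infinity, put $m_0:=1/u'(w_0)$, $L_0(z):=(u')^{-1}(1/z)$ for $z\ge m_0$ and $L(z):=L_0(\max\{z,m_0\})$ for $z\in\mathbb R$. For $\lambda,\mu\in\mathbb R$ the canonical contract is $w_{\lambda,\mu}(y):=L(\lambda+\mu s(y))-w_0$. A piecewise linear option contract is a wage function of the form $w(y)=\max\{\alpha+\beta y,0\}$ with $\alpha,\beta\in\mathbb R$ (when $\beta>0$: zero pay for low output and linearly increasing pay past a strike price). Parametrizations of the families: Gaussian $\mathcal N(a,\sigma^2)$ with $\sigma^2>0$ fixed; exponential density $a^{-1}e^{-y/a}$; Poisson with mean $a$; geometric mass $(1-1/a)^{y-1}(1/a)$ on $\{1,2,\dots\}$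 with $a>1$; binomial $\binom ny a^y(1-a)^{n-y}$ with $n$ fixed and $a\in(0,1)$; gamma density $y^{n-1}e^{-y/a}/(\Gamma(n)a^n)$ with shape $n>0$ fixed ($a>0$ for exponential, Poisson, gamma). *)

(* Defs.v *)
From HB Require Import structures.
From mathcomp Require Export all_boot all_order all_algebra.
From mathcomp Require Export all_classical all_reals all_analysis.
Export Order.TTheory GRing.Theory Num.Theory.
Export numFieldNormedType.Exports.

Set Implicit Arguments.
Unset Strict Implicit.
Unset Printing Implicit Defensive.


Local Open Scope classical_set_scope.
Local Open Scope ring_scope.

(* Conventions: output takes its values in a set Y of reals; a family of
   densities or mass functions is written curried, f y a = f(y | a), and only
   its values for y in Y and a in the action set A are meaningful. *)

Section Model.
Variable R : realType.
Implicit Types (Y A : set R) (f : R -> R -> R) (u s w : R -> R).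

(* The f(. | a), a in A, are strictly positive probability densities on Y with
   respect to the common dominating Borel measure nu (mass functions when nu is
   the counting measure). *)
Definition positive_densities (nu : {measure set (measurableTypeR R) -> \bar R})
    Y A f : Prop :=
  measurable (Y : set (measurableTypeR R)) /\
  forall a, A a ->
    [/\ measurable_fun (Y : set (measurableTypeR R)) (fun y => f y a),
        (forall y, Y y -> 0 < f y a)
      & (\int[nu]_(y in Y) (f y a)%:E = 1)%E].

(* f constrains eta and psi only on A: at an endpoint of A belonging to A,
   one-sided differentiability there amounts to the existence of a choice of
   eta, psi outside A that is differentiable in the two-sided sense. *)
Definition linear_exp_family Y A f : Prop :=
  exists h eta psi : R -> R,
    (forall a, A a -> derivable eta a 1 /\ derivable psi a 1) /\
    (forall y a, Y y -> A a -> f y a = h y * expR (eta a * y - psi a)).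

Definition score f (a0 : R) (y : R) : R := derive1 (f y) a0 / f y a0.

Definition m0 u (w0 : R) : R := (derive1 u w0)^-1.

(* pinv D g is the inverse of g restricted to D, here of u' on [w0, +oo[. *)
Definition L0 u (w0 z : R) : R := pinv `[w0, +oo[ (derive1 u) z^-1.

Definition L u (w0 z : R) : R := L0 u w0 (Num.max z (m0 u w0)).

Definition canonical_contract u (w0 : R) s (lambda mu : R) (y : R) : R :=
  L u w0 (lambda + mu * s y) - w0.

Definition option_contract Y w : Prop :=
  exists alpha beta : R, forall y, Y y -> w y = Num.max (alpha + beta * y) 0.

(* Mass functions p(k | a) on the natural numbers, read at the reals k%:R
   (Num.truncn k%:R = k); naturals P is the set of the k%:R with P k. *)
Definition on_nat (p : nat -> R -> R) (y a : R) : R := p (Num.truncn y) a.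

Definition naturals (P : set nat) : set R := [set k%:R | k in P].

Definition gaussian (sigma y a : R) : R := normal_pdf a sigma y.

(* exponential_pdf takes the rate, here the inverse of the mean a. *)
Definition exponential (y a : R) : R := exponential_pdf a^-1 y.

Definition poisson : R -> R -> R := on_nat (fun k a => poisson_pmf a k).

Definition geometric_dist : R -> R -> R :=
  on_nat (fun k a => (1 - a^-1) ^+ k.-1 * a^-1).

Definition binomial_dist (n : nat) : R -> R -> R :=
  on_nat (fun k a => binomial_pmf n a k).

Definition Gamma (x : R) : R :=
  \int[lebesgue_measure]_(t in `]0, +oo[) (t `^ (x - 1) * expR (- t)).

Definition gamma_dist (n y a : R) : R :=
  y `^ (n - 1) * expR (- (y / a)) / (Gamma n * a `^ n).

End Model.

Arguments naturals : clear implicits.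
Arguments exponential : clear implicits.
Arguments poisson : clear implicits.
Arguments geometric_dist : clear implicits.
Arguments binomial_dist : clear implicits.

(* Main.v *)
(* For u = log the inverse marginal utility is L z = max (z, w0), so the contract
   is w = max (lambda + mu s - w0, 0). In a linear exponential family the score
   s y = eta'(a0) y - psi'(a0) is affine in y, hence w is an option contract. *)
Require Import Defs.
From mathcomp Require Import measurable_realfun ring lra.

Local Open Scope classical_set_scope.
Local Open Scope ring_scope.

(** * The contract under logarithmic utility *)

(** Here [m0] is [w0], and [max z w0] is a point of [[w0, +oo[] whose marginal utility is exactly
    the argument of [pinv]. Since [x^-1] is injective there, [pinv] returns that point. *)
Lemma L_ln {R : realType} {w0 : R} (hw0 : 0 < w0) (z : R) :
  L (@ln R) w0 z = Num.max z w0.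
Proof.
have dln (x : R) : 0 < x -> (@ln R)^`()%classic x = x^-1.
  by move=> x0; rewrite derive1E; apply: derive_val; exact: is_derive1_ln.
rewrite /L /m0 dln// invrK /L0.
have zw0 : 0 < Num.max z w0 by rewrite lt_max hw0 orbT.
have D0 (x : R) : x \in `[w0, +oo[%classic -> 0 < x.
  by rewrite inE/= in_itv/= andbT; exact: lt_le_trans.
rewrite -[X in pinv _ _ X]dln// pinvKV//; last first.
  by rewrite inE/= in_itv/= andbT le_max lexx orbT.
by move=> x y /D0 x0 /D0 y0; rewrite !dln// => /invr_inj.
Qed.

(** The score is a logarithmic derivative, so [h] and the exponential cancel. The formula for [f] is
    asked only near [a0], which is all that a derivative at [a0] sees. *)
Lemma score_exp {R : realType} {h y a0 : R} {f : R -> R -> R} {eta psi : R -> R} :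
  h != 0 -> derivable eta a0 1 -> derivable psi a0 1 ->
  (\near a0, f y a0 = h * expR (eta a0 * y - psi a0)) ->
  score f a0 y = eta^`()%classic a0 * y - psi^`()%classic a0.
Proof.
move=> h0 deta dpsi fE.
rewrite /score (nbhs_singleton fE) !derive1E.
rewrite (near_eq_derive _ fE) ?oner_eq0//.
set E := expR _.
have := derivableP deta; have := derivableP dpsi => Hp He.
have -> : 'D_1 (fun a => h * expR (eta a * y - psi a)) a0 =
    h * (E * ('D_1 eta a0 * y - 'D_1 psi a0)).
  pose g := fun a => eta a * y - psi a.
  have Hg : is_derive a0 1 g ('D_1 eta a0 * y - 'D_1 psi a0).
    apply: is_deriveB; rewrite mulrC.
    have -> : (fun a => eta a * y) = y *: eta by apply/funext => a; rewrite mulrC.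
    exact: is_deriveZ.
  have HE : is_derive a0 1 (fun a => expR (g a))
      (E * ('D_1 eta a0 * y - 'D_1 psi a0)).
    exact: (is_derive1_comp (f := expR) (g := g)).
  by apply: derive_val; apply: (is_deriveZ (f := fun a => expR (g a)) h).
have E0 : E != 0 by rewrite gt_eqF// expR_gt0.
by field; rewrite E0.
Qed.

Lemma contract_option {R : realType} {w0 : R} (hw0 : 0 < w0) {Y A : set R} {a0 : R}
    (ha0 : interior A a0) {f : R -> R -> R} :
  (forall y, Y y -> 0 < f y a0) ->
  linear_exp_family Y A f ->
  forall lambda mu : R,
    option_contract Y (canonical_contract (@ln R) w0 (score f a0) lambda mu).
Proof.
move=> f0 [h [eta [psi [detapsi fE]]]] lambda mu.
have Aa0 : A a0 := nbhs_singleton ha0.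
have [deta dpsi] := detapsi _ Aa0.
(* Intercept and slope come from inserting the affine score into [lambda + mu * s y - w0] and
   collecting the powers of [y]. *)
exists (lambda - mu * psi^`()%classic a0 - w0), (mu * eta^`()%classic a0) => y Yy.
have fy : \near a0, f y a0 = h y * expR (eta a0 * y - psi a0).
  by apply: filterS ha0 => a Aa; exact: fE.
have h0 : h y != 0.
  by apply: contraTneq (f0 y Yy) => hy0; rewrite fE// hy0 mul0r ltxx.
rewrite /canonical_contract L_ln// (score_exp h0 deta dpsi fy).
by rewrite addr_maxl subrr; congr (Num.max _ 0); ring.
Qed.

(** * Distributions on the natural numbers *)

Lemma countable_naturals {R : realType} (P : set nat) : countable (naturals R P).
Proof. exact: (sub_countable (card_image_le _ _) (countableP P)). Qed.

Lemma measurable_countable {R : realType} (Y : set R) :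
  countable Y -> measurable (Y : set (measurableTypeR R)).
Proof. by move=> cY; apply: countable_measurable. Qed.

(** Any preimage taken inside [Y] is a subset of a countable set, hence Borel. *)
Lemma measurable_fun_countable {R : realType} (Y : set R) (f : R -> R) :
  countable Y -> measurable_fun (Y : set (measurableTypeR R)) f.
Proof.
move=> cY _ B _; apply: measurable_countable.
by apply: sub_countable cY; apply: subset_card_le; exact: subIsetl.
Qed.

Lemma integral_counting_set1 {R : realType} (f : R -> R) (x : R) :
  (\int[@counting (measurableTypeR R) R]_(y in [set x]) (f y)%:E = (f x)%:E)%E.
Proof.
transitivity (\int[@counting (measurableTypeR R) R]_(y in [set x]) cst (f x)%:E y)%E.
  by apply: eq_integral => y; rewrite inE => ->.
rewrite integral_cst//.
rewrite -[RHS]mule1; congr (_ * _)%E.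
transitivity (@counting (measurableTypeR R) R [set x]) => //.
by rewrite /counting asboolT// fset_set1 finmap.cardfs1.
Qed.

Lemma integral_counting_naturals {R : realType} (P : set nat) (f : R -> R) :
  (forall k, P k -> 0 <= f k%:R) ->
  (\int[@counting (measurableTypeR R) R]_(y in naturals R P) (f y)%:E =
    \esum_(k in P) (f k%:R)%:E)%E.
Proof.
(* [F k] is a singleton or empty, so the pieces are disjoint, indexed by all of [nat], and countable
   additivity produces a series. *)
move=> f0; pose F k : set (measurableTypeR R) :=
  if k \in P then [set k%:R] else set0.
have naturalsE : naturals R P = \bigcup_k F k.
  apply/seteqP; split=> [_ [k Pk <-]|y [k _]].
    by exists k => //; rewrite /F mem_set.
  by rewrite /F; case: ifPn => //; rewrite inE => Pk ->; exists k.
have mF k : measurable (F k).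
  by rewrite /F; case: ifP => // _; exact: (measurable_countable (countable1 _)).
rewrite naturalsE ge0_integral_bigcup//; last 3 first.
- apply/measurable_EFinP; apply: measurable_fun_countable.
  by rewrite -naturalsE; exact: countable_naturals.
- by move=> y; rewrite -naturalsE => -[k Pk <-]; rewrite lee_fin f0.
- move=> i j _ _ [y []]; rewrite /F.
  by case: ifP => // _; case: ifP => // _ /= -> /eqP; rewrite eqr_nat => /eqP.
rewrite esum_mkcond -nneseries_esumT; last first.
  by move=> k; case: ifPn => //; rewrite inE lee_fin; exact: f0.
apply: eq_eseriesr => k _; rewrite /F; case: ifP => _.
  exact: integral_counting_set1.
by rewrite integral_set0.
Qed.

(** Reduces each discrete family to positive masses with sum one; measurability comes from the
    countable support. *)
Lemma positive_densities_on_nat {R : realType} (P : set nat) (A : set R)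
    (p : nat -> R -> R) :
  (forall k a, P k -> A a -> 0 < p k a) ->
  (forall a, A a -> \esum_(k in P) (p k a)%:E = 1)%E ->
  positive_densities counting (naturals R P) A (on_nat p).
Proof.
move=> p0 p1; split.
  by apply: measurable_countable; exact: countable_naturals.
move=> a Aa; split.
- by apply: measurable_fun_countable; exact: countable_naturals.
- by move=> _ [k Pk <-]; rewrite /on_nat natrK; exact: p0.
rewrite -(p1 a Aa) integral_counting_naturals.
  by apply: eq_esum => k _; rewrite /on_nat natrK.
by move=> k Pk; rewrite /on_nat natrK ltW// p0.
Qed.

Lemma poisson_densities {R : realType} (A : set R) :
  A `<=` `]0, +oo[ -> positive_densities counting (naturals R setT) A (poisson R).
Proof.
move=> A0; have {}A0 a : A a -> 0 < a by move=> /A0 /=; rewrite in_itv/= andbT.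
apply: positive_densities_on_nat => [k a _ /A0 a0|a /A0 a0].
  by rewrite /poisson_pmf a0 !mulr_gt0 ?expR_gt0 ?exprn_gt0// invr_gt0 ltr0n fact_gt0.
(* The sum of the masses is the value on [setT] of a probability measure. *)
have : poisson_prob a 0 setT = 1%E by exact: probability_setT.
by rewrite /poisson_prob a0.
Qed.

Lemma poisson_exp_family {R : realType} (A : set R) :
  A `<=` `]0, +oo[ -> linear_exp_family (naturals R setT) A (poisson R).
Proof.
move=> A0; have {}A0 a : A a -> 0 < a by move=> /A0 /=; rewrite in_itv/= andbT.
(* Read off from [a^k e^(-a) / k! = (1 / k!) e^(k ln a - a)]. *)
exists (fun y => (Num.truncn y)`!%:R^-1), (@ln R), id; split.
  by move=> a /A0 a0; split=> //; apply: ex_derive; exact: is_derive1_ln.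
move=> _ a [k _ <-] /A0 a0; rewrite /poisson /on_nat natrK /poisson_pmf a0.
by rewrite expRD expRM_natr lnK ?posrE// mulrA [in RHS]mulrC; ring.
Qed.

(** Shifting the index by [succn] removes the predecessor in the exponent and leaves the geometric
    series of ratio [q]. *)
Lemma esum_geometric {R : realType} (q : R) : 0 <= q < 1 ->
  (\esum_(k in [set k | (1 <= k)%N]) (q ^+ k.-1 * (1 - q))%:E = 1)%E.
Proof.
move=> /andP[q0 q1]; have q1' : 0 <= 1 - q by rewrite subr_ge0 ltW.
rewrite (@reindex_esum _ _ _ setT _ succn); last first.
  split=> [k _ //|k l _ _ [] //|[//|k] _]; by exists k.
rewrite -nneseries_esumT => [|k]; last first.
  by rewrite lee_fin mulr_ge0 ?exprn_ge0.
apply: cvg_lim => //=.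
(* The limit is put in the form first term over one minus ratio. *)
have -> : 1%E = ((1 - q) / (1 - q))%:E :> \bar R.
  by rewrite divff// subr_eq0 gt_eqF.
under eq_fun do rewrite sumEFin.
apply: cvg_EFin; first exact: nearW.
have := @cvg_geometric_series R (1 - q) q; rewrite ger0_norm// => /(_ q1).
apply: cvg_trans; apply: near_eq_cvg; apply: nearW => n /=.
by rewrite seriesEnat/=; apply: eq_bigr => k _; rewrite mulrC.
Qed.

Lemma geometric_densities {R : realType} (A : set R) :
  A `<=` `]1, +oo[ ->
  positive_densities counting (naturals R [set k | (1 <= k)%N]) A
    (geometric_dist R).
Proof.
move=> A1; have {}A1 a : A a -> 0 < a^-1 < 1.
  move=> /A1 /=; rewrite in_itv/= andbT => a1.
  by rewrite invr_gt0 invf_lt1 (lt_trans ltr01 a1).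
apply: positive_densities_on_nat => [k a _ /A1 /andP[a0 a1]|a /A1 /andP[a0 a1]].
  by rewrite mulr_gt0// exprn_gt0// subr_gt0.
(* With [q = 1 - a^-1], the success probability [a^-1] is [1 - q]. *)
rewrite -(@esum_geometric R (1 - a^-1)); last by apply/andP; split; lra.
by apply: eq_esum => k _; congr (_ * _)%:E; ring.
Qed.

Lemma geometric_exp_family {R : realType} (A : set R) :
  A `<=` `]1, +oo[ ->
  linear_exp_family (naturals R [set k | (1 <= k)%N]) A (geometric_dist R).
Proof.
move=> A1; have {}A1 a : A a -> 1 < a by move=> /A1 /=; rewrite in_itv/= andbT.
pose q (a : R) := 1 - a^-1.
have q0 a : A a -> 0 < q a.
  by move=> /A1 a1; rewrite subr_gt0 invf_lt1// (lt_trans ltr01 a1).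
have dlnq a : A a -> derivable (fun a => ln (q a)) a 1.
  move=> Aa; have a0 : a != 0 by rewrite gt_eqF// (lt_trans ltr01 (A1 _ Aa)).
  apply: (@ex_derive _ _ _ _ _ _ _).
  apply: (is_derive1_comp (f := @ln R) (g := q)).
    exact: is_derive1_ln (q0 _ Aa).
  by apply: is_deriveB; exact: is_deriveV.
(* The exponent of [q] is [y - 1], not [y]; the missing factor puts the extra [ln (q a)] into
   [psi]. *)
exists (cst 1), (fun a => ln (q a)), (fun a => ln (q a) + ln a); split.
  move=> a Aa; split; first exact: dlnq.
  apply: derivableD; first exact: dlnq.
  by apply: ex_derive; apply: is_derive1_ln; rewrite (lt_trans ltr01 (A1 _ Aa)).
move=> _ a [[//|k] _ <-] Aa; rewrite /geometric_dist /on_nat natrK /=.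
have a0 := lt_trans ltr01 (A1 _ Aa).
rewrite -/(q a) mul1r -natr1 mulrDr mulr1 opprD addrA addrK.
by rewrite expRD expRN lnK ?posrE// expRM_natr lnK ?posrE// q0.
Qed.

Lemma binomial_densities {R : realType} (n : nat) (A : set R) :
  A `<=` `]0, 1[ ->
  positive_densities counting (naturals R [set k | (k <= n)%N]) A
    (binomial_dist R n).
Proof.
move=> A01; have {}A01 a : A a -> 0 < a < 1 by move=> /A01 /=; rewrite in_itv.
apply: positive_densities_on_nat => [k a /= kn /A01 /andP[a0 a1]|a /A01 /andP[a0 a1]].
  rewrite /binomial_pmf pmulrn_lgt0 ?bin_gt0// mulr_gt0 ?exprn_gt0//.
  by rewrite subr_gt0.
have : binomial_prob n a setT = 1%E by exact: probability_setT.
rewrite /binomial_prob !ltW//= => <-.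
(* [binomial_prob] sums over all of [nat]; the terms with [k > n] vanish with the binomial
   coefficient. *)
rewrite esum_mkcond; apply: eq_esum => k _; case: ifPn => //.
rewrite notin_setE/= => /negP; rewrite -ltnNge => nk.
by rewrite /binomial_pmf bin_small.
Qed.

Lemma binomial_exp_family {R : realType} (n : nat) (A : set R) :
  A `<=` `]0, 1[ ->
  linear_exp_family (naturals R [set k | (k <= n)%N]) A (binomial_dist R n).
Proof.
move=> A01; have {}A01 a : A a -> 0 < a < 1 by move=> /A01 /=; rewrite in_itv.
have dln1B (a : R) : A a -> derivable (fun a : R => ln (1 - a)) a 1.
  move=> /A01 /andP[_ a1]; apply: (@ex_derive _ _ _ _ _ _ _).
  apply: (is_derive1_comp (f := @ln R) (g := fun a => 1 - a)).
  by apply: is_derive1_ln; rewrite subr_gt0.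
(* [eta] is the log-odds: [a^k (1 - a)^(n - k)] is [(a / (1 - a))^k (1 - a)^n]. *)
exists (fun y => 'C(n, Num.truncn y)%:R), (fun a => ln a - ln (1 - a)),
  (fun a => - n%:R * ln (1 - a)); split.
  move=> a Aa; split; last by apply: derivableM => //; exact: dln1B.
  apply: derivableB; last exact: dln1B.
  by apply: ex_derive; apply: is_derive1_ln; case/andP: (A01 _ Aa).
move=> _ a [k /= kn <-] /A01 /andP[a0 a1].
rewrite /binomial_dist /on_nat natrK /binomial_pmf -mulr_natl; congr (_ * _).
rewrite (_ : _ - _ = ln a * k%:R + ln (1 - a) * (n - k)%:R); last first.
  by rewrite natrB//; ring.
by rewrite expRD !expRM_natr !lnK ?posrE ?subr_gt0.
Qed.

(** * Distributions with a Lebesgue density *)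

Lemma gaussian_densities {R : realType} (A : set R) (sigma : R) : 0 < sigma ->
  positive_densities lebesgue_measure setT A (gaussian sigma).
Proof.
move=> s0; split; first exact: measurableT.
move=> a _; split.
- exact: measurable_normal_pdf.
- move=> y _; rewrite /gaussian normal_pdfE ?gt_eqF// mulr_gt0 ?expR_gt0//.
  by rewrite normal_peak_gt0 ?gt_eqF.
- exact: integral_normal_pdf.
Qed.

Lemma gaussian_exp_family {R : realType} (A : set R) (sigma : R) : 0 < sigma ->
  linear_exp_family setT A (gaussian sigma).
Proof.
move=> s0; pose c := (sigma ^+ 2)^-1.
(* Expanding [(y - a)^2], the square of [y] goes into [h], the cross term into [eta] and the square
   of [a] into [psi]. *)
exists (fun y => normal_peak sigma * expR (- (y ^+ 2) * c / 2)),
  (fun a => a * c), (fun a => a ^+ 2 * (c / 2)); split=> [a _|y a _ _].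
  by split; apply: ex_derive.
rewrite /gaussian normal_pdfE ?gt_eqF// -[RHS]mulrA -expRD; congr (_ * expR _).
by rewrite -mulr_natr invfM -/c; field.
Qed.

Lemma exponential_densities {R : realType} (A : set R) :
  A `<=` `]0, +oo[ ->
  positive_densities lebesgue_measure `[0, +oo[ A (exponential R).
Proof.
move=> A0; split=> [|a /A0]; first exact: measurable_itv.
rewrite /= in_itv/= andbT => a0; have ai0 : 0 < a^-1 by rewrite invr_gt0.
split.
- by apply: measurable_funTS; exact: measurable_exponential_pdf.
- move=> y; rewrite /= in_itv/= andbT => y0.
  by rewrite /exponential exponential_pdfE// mulr_gt0 ?expR_gt0.
(* [exponential_pdf] is zero off [[0, +oo[], so its integral over the line is the one over the
   support. *)
- rewrite -(integral_exponential_pdf ai0) [LHS]integral_mkcond.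
  apply: eq_integral => y _; rewrite patchE; case: ifPn => // yn.
  by rewrite /exponential_pdf patchE (negbTE yn).
Qed.

Lemma exponential_exp_family {R : realType} (A : set R) :
  A `<=` `]0, +oo[ -> linear_exp_family `[0, +oo[ A (exponential R).
Proof.
move=> A0; have {}A0 a : A a -> 0 < a by move=> /A0 /=; rewrite in_itv/= andbT.
exists (cst 1), (fun a => - a^-1), (@ln R); split=> [a /A0 a0|y a].
  have a0' : a != 0 by rewrite gt_eqF.
  split; first by apply: derivableN; apply: derivableV.
  by apply: ex_derive; exact: is_derive1_ln.
rewrite /= in_itv/= andbT => y0 /A0 a0.
rewrite /exponential exponential_pdfE// mul1r expRD expRN lnK ?posrE//.
by rewrite mulrC.
Qed.

(* The gamma integrand with shape < 1 is singular at 0, where the library's change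
   of variables does not apply: it is used on [c / (k + 1), +oo[ first. *)
Lemma cvg_integral_itvcy {R : realType} (f : R -> R) (c : R) : 0 < c ->
  (forall x, 0 < x -> 0 <= f x) -> measurable_fun (`]0, +oo[ : set R) f ->
  (\int[lebesgue_measure]_(x in `[(c * k.+1%:R^-1)%R, +oo[) (f x)%:E
      @[k --> \oo] --> \int[lebesgue_measure]_(x in `]0%R, +oo[) (f x)%:E)%E.
Proof.
move=> c0 f0 mf.
pose F k : set R := `[c * k.+1%:R^-1, +oo[%classic.
have F0 k : F k `<=` `]0, +oo[.
  move=> x; rewrite /F/= !in_itv/= !andbT; apply: lt_le_trans.
  by rewrite mulr_gt0// invr_gt0.
have -> : `]0, +oo[%classic = \bigcup_k F k.
  apply/seteqP; split=> [x|x [k _ /F0]//].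
  rewrite /= in_itv/= andbT => x0.
  have [k kx] := ltr_add_invr (y := 0) (x := x / c) ltac:(by rewrite divr_gt0).
  exists k => //; rewrite /F/= in_itv/= andbT ltW//.
  by rewrite mulrC -ltr_pdivlMr// -[ltLHS]add0r.
apply: ge0_nondecreasing_set_cvg_integral.
- move=> i j ij; apply/subsetPset => x; rewrite /F/= !in_itv/= !andbT.
  by apply: le_trans; rewrite ler_pM2l// lef_pV2 ?posrE// ler_nat ltnS.
- by move=> i; exact: measurable_itv.
- move=> i; apply/measurable_EFinP.
  by apply: measurable_funS mf; [exact: measurable_itv|exact: F0].
- by move=> i x /F0; rewrite /= in_itv/= andbT lee_fin; exact: f0.
Qed.

(** The map [x |-> a * x] sends [[1 / (k + 1), +oo[] onto [[a / (k + 1), +oo[], where the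
    substitution rule applies. Both truncated integrals converge to those over the open half-line,
    and the limit is unique. *)
Lemma integral_scale {R : realType} (f : R -> R) (a : R) : 0 < a ->
  (forall x, 0 < x -> 0 <= f x) -> (forall x, 0 < x -> {for x, continuous f}) ->
  (\int[lebesgue_measure]_(x in `]0%R, +oo[) (f x)%:E =
   \int[lebesgue_measure]_(x in `]0%R, +oo[) (f (a * x) * a)%:E)%E.
Proof.
move=> a0 f0 cf.
have mf (g : R -> R) : (forall x, 0 < x -> {for x, continuous g}) ->
    measurable_fun (`]0, +oo[ : set R) g.
  move=> cg; apply: open_continuous_measurable_fun; first exact: interval_open.
  by move=> x; rewrite inE/= in_itv/= andbT; exact: cg.
have cfa x : 0 < x -> {for x, continuous (fun x => f (a * x) * a)}.
  move=> x0; apply: cvgM; last exact: cvg_cst.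
  apply: (continuous_comp (f := fun x => a * x) (g := f)).
    exact: mulrl_continuous.
  by apply: cf; rewrite mulr_gt0.
have fa0 x : 0 < x -> 0 <= f (a * x) * a.
  by move=> x0; rewrite mulr_ge0 ?f0 ?ltW// mulr_gt0.
have := @cvg_integral_itvcy R _ a a0 f0 (mf _ cf).
have := @cvg_integral_itvcy R _ 1 ltr01 fa0 (mf _ cfa).
suff /funext -> : (fun k : nat => \int[lebesgue_measure]_(x in
      `[(1 * k.+1%:R^-1)%R, +oo[) (f (a * x) * a)%:E)%E =1
    (fun k : nat => \int[lebesgue_measure]_(x in
      `[(a * k.+1%:R^-1)%R, +oo[) (f x)%:E)%E.
  by move=> l1 l2; exact: (cvg_unique _ l2 l1).
move=> k; rewrite mul1r; set e : R := _^-1.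
have e0 : 0 < e by rewrite invr_gt0.
pose F (x : R) := a * x.
have dF : F^`()%classic = cst a.
  by apply/funext => x; rewrite derive1Ml// derive1_id mulr1.
rewrite -/(F e) (increasing_ge0_integration_by_substitutiony (F := F)).
- by apply: eq_integral => x _; rewrite /= dF.
- by move=> x y _ _; rewrite /F ltr_pM2l.
- by rewrite dF => x _; exact: cvg_cst.
- by rewrite dF; exact: is_cvg_cst.
- by rewrite dF; exact: is_cvg_cst.
- split; first by move=> x _; apply: derivableM.
  by apply: cvg_at_right_filter; exact: mulrl_continuous.
- by apply: gt0_cvgMry => //; exact: cvg_id.
- apply: continuous_in_subspaceT => x; rewrite inE/= in_itv/= andbT => aex.
  by apply: cf; apply: lt_le_trans aex; rewrite mulr_gt0.
- move=> x; rewrite in_itv/= andbT => aex; apply: f0.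
  by apply: lt_trans aex; rewrite mulr_gt0.
Qed.

(** * The gamma integral *)

Section GammaIntegral.
Context {R : realType} {n : R} (n0 : 0 < n).

Let g (t : R) : R := t `^ (n - 1) * expR (- t).

Lemma continuous_powR (p x : R) : 0 < x -> {for x, continuous (@powR R ^~ p)}.
Proof.
move=> x0; apply/differentiable_continuous/derivable1_diffP.
by apply: derivable_powR; rewrite in_itv/= andbT.
Qed.

Lemma continuous_gamma_integrand (x : R) : 0 < x -> {for x, continuous g}.
Proof.
move=> x0; apply: cvgM; first exact: continuous_powR.
by apply: continuous_comp; [exact: continuousN|exact: continuous_expR].
Qed.

Lemma measurable_gamma_integrand : measurable_fun (`]0, +oo[ : set R) g.
Proof.
apply: open_continuous_measurable_fun; first exact: interval_open.
by move=> x; rewrite inE/= in_itv/= andbT; exact: continuous_gamma_integrand.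
Qed.

Lemma gamma_integrand_ge0 (x : R) : 0 <= g x.
Proof. by rewrite mulr_ge0 ?powR_ge0 ?expR_ge0. Qed.

(** The antiderivative [x^n / n] equals [n^-1] at 1 and is nonnegative at [e], so the bound is
    uniform in [e]. *)
Lemma integral_powR_itv01 (e : R) : 0 < e < 1 ->
  (\int[lebesgue_measure]_(x in `[e, 1%R]) (x `^ (n - 1))%:E <= (n^-1)%:E)%E.
Proof.
move=> /andP[e0 e1]; pose F (x : R) := n^-1 * x `^ n.
have x0 (x : R) : e <= x -> 0 < x by exact: lt_le_trans.
have cF (x : R) : e <= x -> {for x, continuous F}.
  by move=> /x0 x1; apply: cvgM; [exact: cvg_cst|exact: continuous_powR].
rewrite (@continuous_FTC2 R _ F)//.
- rewrite -EFinB lee_fin /F powR1 mulr1 lerBlDr lerDl.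
  by rewrite mulr_ge0 ?powR_ge0// invr_ge0 ltW.
- apply: continuous_in_subspaceT => x; rewrite inE/= in_itv/= => /andP[/x0 x1 _].
  exact: continuous_powR.
- split.
  + move=> x; rewrite in_itv/= => /andP[/ltW/x0 x1 _].
    by apply: derivableM => //; apply: derivable_powR; rewrite in_itv/= andbT.
  + by apply: cvg_at_right_filter; exact: cF.
  + by apply: cvg_at_left_filter; apply: cF; exact: ltW.
- move=> x; rewrite in_itv/= => /andP[/ltW/x0 x1 _].
  rewrite /F derive1Ml; last by apply: derivable_powR; rewrite in_itv/= andbT.
  by rewrite powR_derive1 ?in_itv/= ?andbT// mulKf// gt_eqF.
Qed.

(* [ln (t / 2n) <= t / 2n] gives [t^n <= (2n)^n e^(t/2)]. *)
Lemma gamma_integrand_le_exp (t : R) : 1 <= t ->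
  g t <= (2 * (2 * n) `^ n) * exponential_pdf 2^-1 t.
Proof.
move=> t1; have t0 : 0 < t by exact: lt_le_trans t1.
have n2 : 0 < 2 * n by rewrite mulr_gt0.
have tn : t `^ (n - 1) <= (2 * n) `^ n * expR (t / 2).
  apply: (@le_trans _ _ (t `^ n)); first by rewrite ler_powR// lerBlDr lerDl.
  rewrite /powR !gt_eqF// -expRD ler_expR.
  have : ln (t / (2 * n)) <= t / (2 * n) by rewrite ltW// ln_sublinear ?divr_gt0.
  rewrite ln_div ?posrE// lerBlDr -(ler_pM2l n0) => /le_trans; apply.
  rewrite mulrDr addrC lerD2l le_eqVlt; apply/orP; left; apply/eqP.
  by field; rewrite gt_eqF.
(* The leading 2 cancels the rate 1/2 in front of the exponential density, and
   [e^(t/2) e^(-t) = e^(-t/2)]. *)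
rewrite exponential_pdfE; last exact: ltW.
rewrite [leRHS](_ : _ = (2 * n) `^ n * expR (t / 2) * expR (- t)).
  by rewrite ler_pM2r ?expR_gt0.
rewrite -[RHS]mulrA -expRD (_ : t / 2 - t = - 2^-1 * t); last by field.
by field.
Qed.

(** The integral is split at 1. Below 1, [e^(-x) <= 1] leaves a power of [x]; above 1, a multiple of
    an exponential density dominates, and its total mass is one. *)
Lemma integral_gamma_integrand_le (e : R) : 0 < e < 1 ->
  (\int[lebesgue_measure]_(x in `[e, +oo[) (g x)%:E <=
    (n^-1 + 2 * (2 * n) `^ n)%:E)%E.
Proof.
move=> /andP[e0 e1].
have sub0 (D : set R) : D `<=` `[e, +oo[ -> D `<=` `]0, +oo[.
  move=> De x /De; rewrite /= !in_itv/= !andbT; exact: lt_le_trans.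
have mg (D : set R) : measurable D -> D `<=` `[e, +oo[ ->
    measurable_fun D (EFin \o g).
  move=> mD De; apply/measurable_EFinP.
  by apply: measurable_funS measurable_gamma_integrand => //; exact: sub0.
have e1' : `[e, 1[ `<=` `[e, +oo[.
  by move=> x; rewrite /= !in_itv/= andbT => /andP[].
have e1y : `[1, +oo[ `<=` `[e, +oo[.
  by move=> x; rewrite /= !in_itv/= !andbT; apply: le_trans; exact: ltW.
rewrite (@itv_bndbnd_setU _ _ _ (BLeft 1)) ?bnd_simp//; last exact: ltW.
rewrite ge0_integral_setU//=; last 3 first.
- by apply: mg; [exact: measurableU|rewrite subUset].
- by move=> x _; rewrite lee_fin gamma_integrand_ge0.
- apply/disj_setPS => x []; rewrite /= !in_itv/= andbT => /andP[_ x1].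
  by rewrite leNgt x1.
rewrite EFinD.
apply: leeD.
  apply: le_trans (integral_powR_itv01 e _); last by rewrite e0.
  have mp : measurable_fun (`[e, 1] : set R) (fun x : R => (x `^ (n - 1))%:E).
    apply/measurable_EFinP; apply: measurable_funTS; exact: measurable_powR.
  have e11 : `[e, 1[ `<=` `[e, 1].
    by move=> x; rewrite /= !in_itv/= => /andP[-> /ltW].
  apply: (@le_trans _ _
      (\int[lebesgue_measure]_(x in `[e, 1%R[) (x `^ (n - 1))%:E)%E).
    apply: ge0_le_integral => //.
    - by move=> x _; rewrite lee_fin gamma_integrand_ge0.
    - exact: mg.
    - by apply: measurable_funS mp.
    - move=> x; rewrite /= in_itv/= => /andP[ex _].
      rewrite lee_fin ler_piMr ?powR_ge0// -expR0 ler_expR oppr_le0.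
      by apply: le_trans ex; exact: ltW.
  (* Enlarging [[e, 1[] to [[e, 1]] reaches the interval on which the power was integrated. *)
  apply: ge0_subset_integral => //.
  by move=> x _; rewrite lee_fin powR_ge0.
set C := 2 * _; have C0 : 0 <= C by rewrite mulr_ge0 ?powR_ge0.
have pdf0 (x : R) : 0 <= exponential_pdf 2^-1 x by apply: exponential_pdf_ge0.
have mpdf : measurable_fun [set: R] (fun x : R => (exponential_pdf 2^-1 x)%:E).
  by apply/measurable_EFinP; exact: measurable_exponential_pdf.
have m1pdf : measurable_fun (`[1, +oo[ : set R)
    (fun x : R => (exponential_pdf 2^-1 x)%:E) by exact: measurable_funTS.
apply: (@le_trans _ _ (\int[lebesgue_measure]_(x in `[1%R, +oo[)
    (C%:E * (exponential_pdf 2^-1 x)%:E))%E).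
  apply: ge0_le_integral => //.
  - by move=> x _; rewrite lee_fin gamma_integrand_ge0.
  - exact: mg.
  - exact: measurable_funeM.
  - move=> x; rewrite /= in_itv/= andbT => x1.
    by rewrite -EFinM lee_fin gamma_integrand_le_exp.
rewrite ge0_integralZl//; last by move=> x _; rewrite lee_fin.
rewrite -[leRHS]mule1 lee_wpmul2l ?lee_fin//.
rewrite -(@integral_exponential_pdf R 2^-1) ?invr_gt0//.
by apply: ge0_subset_integral => // x _; rewrite lee_fin.
Qed.

(** The bound on [[e, +oo[] does not depend on [e], so it survives the limit as [e] tends to 0. *)
Lemma integral_gamma_integrand_lty :
  (\int[lebesgue_measure]_(x in `]0%R, +oo[) (g x)%:E < +oo)%E.
Proof.
apply: (@le_lt_trans _ _ (n^-1 + 2 * (2 * n) `^ n)%:E); last exact: ltry.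
(* The factor 1/2 keeps every cut-off [1 / (2 (k + 1))] strictly below 1, including at [k = 0]. *)
have half0 : 0 < 2^-1 :> R by rewrite invr_gt0.
have := @cvg_integral_itvcy R g 2^-1 half0 (fun x _ => gamma_integrand_ge0 x)
  measurable_gamma_integrand.
move=> cvgI; rewrite -(cvg_lim _ cvgI)//; apply: lime_le.
  by apply/cvg_ex; eexists; exact: cvgI.
apply: nearW => k; apply: integral_gamma_integrand_le.
have k0 : 0 < k.+1%:R^-1 :> R by rewrite invr_gt0.
have k1 : k.+1%:R^-1 <= 1 :> R by rewrite invf_le1// ler1n.
by move: (k.+1%:R^-1) k0 k1 => q q0 q1; apply/andP; split; lra.
Qed.

Lemma integral_gamma_integrand_gt0 :
  (0 < \int[lebesgue_measure]_(x in `]0%R, +oo[) (g x)%:E)%E.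
Proof.
have n1 : -1 <= n - 1 by rewrite lerBrDr addNr ltW.
have sub12 : (`[1, 2] : set R) `<=` `]0, +oo[.
  by move=> x; rewrite /= !in_itv/= andbT => /andP[x1 _]; exact: lt_le_trans x1.
have mg : measurable_fun (`]0, +oo[ : set R) (EFin \o g).
  by apply/measurable_EFinP; exact: measurable_gamma_integrand.
(* On [[1, 2]], [n - 1 >= -1] gives [x^(n - 1) >= x^-1 >= 1/2], and [e^(-x) >= e^(-2)]; so [m]
   bounds the integrand from below on an interval of length one. *)
pose m := 2^-1 * expR (- 2) : R.
have m0 : 0 < m by rewrite mulr_gt0 ?expR_gt0.
apply: (@lt_le_trans _ _ (\int[lebesgue_measure]_(x in `[1%R, 2%R]) (cst m%:E x))%E).
  rewrite integral_cst//= lebesgue_measure_itv/= lte_fin ltr1n -EFinB -EFinM lte_fin.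
  by rewrite mulr_gt0// subr_gt0 ltr1n.
apply: (@le_trans _ _ (\int[lebesgue_measure]_(x in `[1%R, 2%R]) (g x)%:E)%E).
  apply: ge0_le_integral => //.
  - by move=> x _; rewrite lee_fin ltW.
  - exact: measurable_funS mg.
  - move=> x; rewrite /= in_itv/= => /andP[x1 x2]; rewrite lee_fin.
    have x0 : 0 < x by exact: lt_le_trans x1.
    rewrite ler_pM ?invr_ge0 ?expR_ge0// ?ler_expR ?lerN2//.
    apply: (@le_trans _ _ (x `^ (-1))).
      by rewrite powR_inv1 ?(ltW x0)// lef_pV2 ?posrE.
    exact: ler_powR.
by apply: ge0_subset_integral => // x _; rewrite lee_fin gamma_integrand_ge0.
Qed.

(** [Gamma] is a real-valued integral, which would default to 0 if the extended one were infinite;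
    finiteness makes the two agree. *)
Lemma integral_Gamma :
  (\int[lebesgue_measure]_(x in `]0%R, +oo[) (g x)%:E = (Gamma n)%:E)%E.
Proof.
rewrite /Gamma /Rintegral fineK// ge0_fin_numE ?integral_gamma_integrand_lty//.
by apply: ltW; exact: integral_gamma_integrand_gt0.
Qed.

Lemma Gamma_gt0 : 0 < Gamma n.
Proof. by rewrite -lte_fin -integral_Gamma integral_gamma_integrand_gt0. Qed.

End GammaIntegral.

(** * The gamma distribution *)

Lemma gamma_densities {R : realType} (A : set R) (n : R) : 0 < n ->
  A `<=` `]0, +oo[ ->
  positive_densities lebesgue_measure `]0, +oo[ A (gamma_dist n).
Proof.
move=> n0 A0; split=> [|a /A0]; first exact: measurable_itv.
rewrite /= in_itv/= andbT => a0.
have G0 := Gamma_gt0 n0; have an0 : 0 < a `^ n by exact: powR_gt0.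
have Ga0 : 0 < Gamma n * a `^ n by rewrite mulr_gt0.
have cgamma (y : R) : 0 < y -> {for y, continuous (gamma_dist n ^~ a)}.
  move=> y0; apply: cvgM; last exact: cvg_cst.
  apply: cvgM; first exact: continuous_powR.
  apply: (@continuous_comp R R R (fun y : R => - (y / a)) (@expR R)).
    by apply: continuousN; exact: mulrr_continuous.
  exact: continuous_expR.
have gamma0 (y : R) : 0 < y -> 0 < gamma_dist n y a.
  by move=> y0; rewrite divr_gt0// mulr_gt0 ?expR_gt0 ?powR_gt0.
split.
- apply: open_continuous_measurable_fun; first exact: interval_open.
  by move=> x; rewrite inE/= in_itv/= andbT; exact: cgamma.
- by move=> y; rewrite /= in_itv/= andbT; exact: gamma0.
(* Substituting [y = a * x] turns the density of scale [a] into the gamma integrand divided by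
   [Gamma n]. *)
rewrite (integral_scale _ _ a0)//; last by move=> x /gamma0/ltW.
transitivity (\int[lebesgue_measure]_(x in `]0%R, +oo[)
    (((Gamma n)^-1)%:E * (x `^ (n - 1) * expR (- x))%:E))%E.
  apply: eq_integral => x; rewrite inE/= in_itv/= andbT => x0.
  rewrite -EFinM; congr EFin; rewrite /gamma_dist powRM ?ltW//.
  rewrite [a * x]mulrC mulfK ?gt_eqF//.
  (* Writing [a^n] as [a * a^(n - 1)] lets it cancel against the Jacobian [a] and the power of [a]
     in the numerator. *)
  rewrite -(mulr_powRB1 (ltW a0) n0) in an0 *.
  have an1 : a `^ (n - 1) != 0 by rewrite gt_eqF ?powR_gt0.
  by field; rewrite an1 !gt_eqF.
rewrite ge0_integralZl//=.
- by rewrite integral_Gamma// -EFinM mulVf// gt_eqF.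
- by apply/measurable_EFinP; exact: measurable_gamma_integrand.
- by move=> x _; rewrite lee_fin mulr_ge0 ?powR_ge0 ?expR_ge0.
- by rewrite lee_fin invr_ge0 ltW.
Qed.

Lemma gamma_exp_family {R : realType} (A : set R) (n : R) : 0 < n ->
  A `<=` `]0, +oo[ -> linear_exp_family `]0, +oo[ A (gamma_dist n).
Proof.
move=> n0 A0; have {}A0 a : A a -> 0 < a by move=> /A0 /=; rewrite in_itv/= andbT.
(* The normalizing factor [a^(-n)] is [e^(-n ln a)], which gives [psi]. *)
exists (fun y => y `^ (n - 1) / Gamma n), (fun a => - a^-1), (fun a => n * ln a).
split=> [a /A0 a0|y a].
  have a0' : a != 0 by rewrite gt_eqF.
  split; first by apply: derivableN; apply: derivableV.
  by apply: derivableM => //; apply: ex_derive; exact: is_derive1_ln.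
rewrite /= in_itv/= andbT => y0 /A0 a0.
rewrite /gamma_dist expRD [a `^ n]/powR gt_eqF// mulNr [a^-1 * y]mulrC !expRN.
by field; rewrite !gt_eqF ?expR_gt0 ?Gamma_gt0.
Qed.

(** * Option contracts for exponential families and the six named distributions *)

Theorem mainTheorem3 (R : realType) (w0 : R) (hw0 : 0 < w0)
    (A : set R) (hA : is_interval A) (hA0 : A `<=` `[0, +oo[)
    (a0 : R) (ha0 : interior A a0) :
  (forall (nu : {measure set (measurableTypeR R) -> \bar R})
      (Y : set R) (f : R -> R -> R),
    positive_densities nu Y A f ->
    linear_exp_family Y A f ->
    forall lambda mu : R,
      option_contract Y (canonical_contract (@ln R) w0 (score f a0) lambda mu))
  /\
  [/\
  (* Gaussian with fixed variance sigma^2 *)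
  (forall sigma : R, 0 < sigma ->
    [/\ positive_densities lebesgue_measure setT A (gaussian sigma),
        linear_exp_family setT A (gaussian sigma)
      & forall lambda mu : R, option_contract setT
          (canonical_contract (@ln R) w0 (score (gaussian sigma) a0) lambda mu)]),
  (* exponential with mean a *)
  (A `<=` `]0, +oo[ ->
    [/\ positive_densities lebesgue_measure `[0, +oo[ A (exponential R),
        linear_exp_family `[0, +oo[ A (exponential R)
      & forall lambda mu : R, option_contract `[0, +oo[
          (canonical_contract (@ln R) w0 (score (exponential R) a0) lambda mu)]),
  (* Poisson with mean a *)
  (A `<=` `]0, +oo[ ->
    [/\ positive_densities counting (naturals R setT) A (poisson R),
        linear_exp_family (naturals R setT) A (poisson R)
      & forall lambda mu : R, option_contract (naturals R setT)
          (canonical_contract (@ln R) w0 (score (poisson R) a0) lambda mu)])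
  &
  [/\
  (* geometric with mean a *)
  (A `<=` `]1, +oo[ ->
    [/\ positive_densities counting (naturals R [set k | (1 <= k)%N]) A
          (geometric_dist R),
        linear_exp_family (naturals R [set k | (1 <= k)%N]) A (geometric_dist R)
      & forall lambda mu : R, option_contract (naturals R [set k | (1 <= k)%N])
          (canonical_contract (@ln R) w0 (score (geometric_dist R) a0) lambda mu)]),
  (* binomial with n trials and success probability a *)
  (forall n : nat, A `<=` `]0, 1[ ->
    [/\ positive_densities counting (naturals R [set k | (k <= n)%N]) A
          (binomial_dist R n),
        linear_exp_family (naturals R [set k | (k <= n)%N]) A (binomial_dist R n)
      & forall lambda mu : R, option_contract (naturals R [set k | (k <= n)%N])
          (canonical_contract (@ln R) w0 (score (binomial_dist R n) a0) lambda mu)])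
  &
  (* gamma with shape n and scale a *)
  (forall n : R, 0 < n -> A `<=` `]0, +oo[ ->
    [/\ positive_densities lebesgue_measure `]0, +oo[ A (gamma_dist n),
        linear_exp_family `]0, +oo[ A (gamma_dist n)
      & forall lambda mu : R, option_contract `]0, +oo[
          (canonical_contract (@ln R) w0 (score (gamma_dist n) a0) lambda mu)])]].
Proof.
have contract_of_densities nu Y f : positive_densities nu Y A f ->
    linear_exp_family Y A f -> forall lambda mu : R,
    option_contract Y (canonical_contract (@ln R) w0 (score f a0) lambda mu).
  (* An interior point of [A] belongs to [A], so the density at [a0] is positive on [Y]. *)
  move=> [_ /(_ a0 (nbhs_singleton ha0))[_ f0 _]] fE.
  exact (contract_option hw0 ha0 f0 fE).
(* Leaves two facts to supply for each named distribution: that it is a positive density and that it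
   has the exponential form. *)
have family nu Y f : positive_densities nu Y A f -> linear_exp_family Y A f ->
    [/\ positive_densities nu Y A f, linear_exp_family Y A f
      & forall lambda mu : R, option_contract Y
          (canonical_contract (@ln R) w0 (score f a0) lambda mu)].
  by move=> fD fE; split=> //; exact: contract_of_densities fD fE.
split=> //; split; [| | |split].
- move=> sigma s0; apply: family; first exact: gaussian_densities.
  exact: gaussian_exp_family.
- move=> A0; apply: family; first exact: exponential_densities.
  exact: exponential_exp_family.
- move=> A0; apply: family; first exact: poisson_densities.
  exact: poisson_exp_family.
- move=> A1; apply: family; first exact: geometric_densities.
  exact: geometric_exp_family.
- move=> n A01; apply: family; first exact: binomial_densities.
  exact: binomial_exp_family.
- move=> n n0 A0; apply: family; first exact: gamma_densities.
  exact: gamma_exp_family.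
Qed.
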